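(* Let $n\ge 2$, let $h\colon \mathbb X\to\mathbb Y$ be a homeomorphism of a domain $\mathbb X\subset\mathbb R^n$ onto a domain $\mathbb Y\subset\mathbb R^n$, and let $f=h^{-1}\colon\mathbb Y\to\mathbb X$ denote its inverse. Then $h$ is quasiconformal if and only if there is a constant $\mathcal K\ge 1$ such that for every pair $(x_\circ,y_\circ)\in\mathbb X\times\mathbb Y$ with $y_\circ=h(x_\circ)$, the optimal modulus of continuity functions $\omega_h=\omega_h(x_\circ;\cdot)$ and $\omega_f=\omega_f(y_\circ;\cdot)$ satisfy $$\mathcal K^{-1}s\le \omega_h(\omega_f(s))\le \mathcal K s$$ for all sufficiently small $s>0$ (the constant $\mathcal K$ is independent of $(x_\circ,y_\circ)$).
   Context: A domain is a nonempty connected open set; $|\cdot|$ is the Euclidean norm. Optimal modulus of continuity: for a homeomorphism $h\colon\mathbb X\to\mathbb Y$ and $x_\circ\in\mathbb X$, $\omega_h(x_\circ;t)=\max_{|x-x_\circ|=t}|h(x)-h(x_\circ)|$ for $0\le t<\operatorname{dist}(x_\circ,\partial\mathbb X)$ (with distance $+\infty$ if $\mathbb X=\mathbb R^n$); similarly $\omega_f(y_\circ;s)=\max_{|y-y_\circ|=s}|f(y)-f(y_\circ)|$ for $0\le s<\operatorname{dist}(y_\circ,\partial\mathbb Y)$. The composition $\omega_h(\omega_f(s))$ is defined for all small $s>0$. Quasiconformality (metric definition): for $x_\circ\in\mathbb X$ and $0<r<\operatorname{dist}(x_\circ,\partial\mathbb X)$ put $$\mathcal H_h(x_\circ,r)=\frac{\max_{|x-x_\circ|=r}|h(x)-h(x_\circ)|}{\min_{|x-x_\circ|=r}|h(x)-h(x_\circ)|},\qquad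 \mathcal H_h(x_\circ)=\limsup_{r\to0}\mathcal H_h(x_\circ,r)\in[1,\infty].$$ The homeomorphism $h$ is quasiconformal if $\sup_{x_\circ\in\mathbb X}\mathcal H_h(x_\circ)<\infty$. *)

(* Defs.v *)
From HB Require Import structures.
From mathcomp Require Import all_boot all_order all_algebra.
From mathcomp Require Import all_classical all_reals all_analysis.

Set Implicit Arguments.
Unset Strict Implicit.
Unset Printing Implicit Defensive.

Import Order.TTheory GRing.Theory Num.Theory.
Import numFieldNormedType.Exports.

Local Open Scope classical_set_scope.
Local Open Scope ring_scope.

(* The canonical norm on matrices is the sup norm. It induces the same
   topology (used for open, connected, continuous), but the moduli and the
   dilatation below depend on the choice of norm. *)
Definition enorm (R : realType) (n : nat) (x : 'rV[R]_n) : R :=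
  Num.sqrt (\sum_(i < n) x 0 i ^+ 2).

Definition domain (R : realType) (n : nat) (X : set 'rV[R]_n) : Prop :=
  [/\ X !=set0, open X & connected X].

(* Maps between domains are total functions of which only the restrictions to
   the domains are constrained. *)
Definition homeomorphism_with_inverse (R : realType) (n : nat)
    (X Y : set 'rV[R]_n) (h f : 'rV[R]_n -> 'rV[R]_n) : Prop :=
  [/\ set_bij X Y h,
      (forall x, X x -> f (h x) = x),
      {within X, continuous h}
    & {within Y, continuous f}].

Definition sphere_dists (R : realType) (n : nat)
    (h : 'rV[R]_n -> 'rV[R]_n) (x0 : 'rV[R]_n) (t : R) : set R :=
  [set enorm (h x - h x0) | x in [set x | enorm (x - x0) = t]].

(* For 0 <= t < dist(x0, boundary of X) and n >= 1 the sphere is a nonempty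
   compact subset of X, so that the supremum (infimum) is a maximum (minimum)
   for h continuous on X. For other t the values are meaningless; the notions
   below only involve t near 0. *)
Definition omega (R : realType) (n : nat)
    (h : 'rV[R]_n -> 'rV[R]_n) (x0 : 'rV[R]_n) (t : R) : R :=
  sup (sphere_dists h x0 t).

Definition min_stretch (R : realType) (n : nat)
    (h : 'rV[R]_n -> 'rV[R]_n) (x0 : 'rV[R]_n) (t : R) : R :=
  inf (sphere_dists h x0 t).

Definition dilatation_at (R : realType) (n : nat)
    (h : 'rV[R]_n -> 'rV[R]_n) (x0 : 'rV[R]_n) (r : R) : R :=
  omega h x0 r / min_stretch h x0 r.

Definition dilatation (R : realType) (n : nat)
    (h : 'rV[R]_n -> 'rV[R]_n) (x0 : 'rV[R]_n) : \bar R :=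
  limf_esup (fun r : R => (dilatation_at h x0 r)%:E) 0^'+.

Definition quasiconformal (R : realType) (n : nat)
    (X : set 'rV[R]_n) (h : 'rV[R]_n -> 'rV[R]_n) : Prop :=
  (ereal_sup [set dilatation h x0 | x0 in X] < +oo)%E.

(* Main.v *)
(* Put [y0 = h x0]. If [t = omega f y0 s], then [min_stretch h x0 t = s]: as [f]
   is open, the maximum of [enorm (f y - x0)] over the closed ball
   [enorm (y - y0) <= s] is attained on its boundary only, so no point of the
   sphere [enorm (x - x0) = t] is mapped closer to [y0] than [s]. Conversely every
   small [r] is [omega f y0 s] for [s = min_stretch h x0 r], by the intermediate
   value theorem along rays from [y0]. Hence
   [dilatation_at h x0 t = omega h x0 (omega f y0 s) / s], where [t] runs over all
   small radii when [s] does. *)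

Require Import Defs.
From HB Require Import structures.
From mathcomp Require Import all_boot all_order all_algebra.
From mathcomp Require Import all_classical all_reals all_analysis.

Import Order.TTheory GRing.Theory Num.Theory.
Import numFieldNormedType.Exports.

Local Open Scope classical_set_scope.
Local Open Scope ring_scope.

(** * The Euclidean norm, its balls and its spheres *)

Lemma enorm_ge0 (R : realType) (n : nat) (x : 'rV[R]_n) : 0 <= enorm x.
Proof. exact: sqrtr_ge0. Qed.

Lemma enormZ (R : realType) (n : nat) (a : R) (x : 'rV[R]_n) :
  enorm (a *: x) = `|a| * enorm x.
Proof.
rewrite /enorm -sqrtr_sqr -sqrtrM ?sqr_ge0// mulr_sumr.
by congr Num.sqrt; apply: eq_bigr => i _; rewrite mxE exprMn.
Qed.

Lemma enorm0 (R : realType) (n : nat) : enorm (0 : 'rV[R]_n) = 0.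
Proof. by rewrite -(scale0r 0) enormZ normr0 mul0r. Qed.

(** Links the Euclidean norm to the sup norm that generates the topology: Euclidean balls are
    bounded, and small ones fit into any neighbourhood. In the other direction continuity of [enorm]
    is used. *)
Lemma norm_le_enorm (R : realType) (n : nat) (x : 'rV[R]_n) : `|x| <= enorm x.
Proof.
rewrite [leLHS]/Num.norm /= mx_normrE; apply/bigmax_leP; split=> [|[i j] _ /=].
  exact: enorm_ge0.
rewrite (ord1 i) -sqrtr_sqr; apply: ler_wsqrtr.
by rewrite (bigD1 j)//= lerDl sumr_ge0// => k _; rewrite sqr_ge0.
Qed.

Lemma enorm_eq0 (R : realType) (n : nat) (x : 'rV[R]_n) :
  (enorm x == 0) = (x == 0).
Proof.
apply/eqP/eqP => [x0|->]; last exact: enorm0.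
by apply/eqP; rewrite -normr_le0 -x0 norm_le_enorm.
Qed.

Lemma enormB_gt0 (R : realType) (n : nat) (x y : 'rV[R]_n) :
  (0 < enorm (x - y)) = (x != y).
Proof. by rewrite lt_def enorm_ge0 andbT enorm_eq0 subr_eq0. Qed.

Lemma enorm_delta (R : realType) (n : nat) (i : 'I_n) :
  enorm (delta_mx 0 i : 'rV[R]_n) = 1.
Proof.
rewrite /enorm (bigD1 i)//= mxE !eqxx expr1n big1 ?addr0 ?sqrtr1// => j ji.
by rewrite mxE (negbTE ji) andbF expr0n.
Qed.

Lemma enorm_continuous (R : realType) (n : nat) :
  continuous (@enorm R n : 'rV[R]_n -> R).
Proof.
move=> x; apply: continuous_comp; last exact: sqrt_continuous.
apply: continuous_big => [|i _ y]; first exact: add_continuous.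
apply: (@continuous_comp _ _ _ (fun M : 'rV[R]_n => M 0 i)
  (fun t : R => t ^+ 2)).
  exact: coord_continuous.
exact: exprn_continuous.
Qed.

Lemma enormB_continuous (R : realType) (n : nat) (c : 'rV[R]_n) :
  continuous (fun x : 'rV[R]_n => enorm (x - c)).
Proof.
move=> x.
apply: (@continuous_comp _ _ _ (fun x : 'rV[R]_n => x - c) (@enorm R n)).
  by apply: continuousB; [exact: cvg_id|exact: cst_continuous].
exact: enorm_continuous.
Qed.

Lemma compact_enorm_ball (R : realType) (n : nat) (c : 'rV[R]_n) (r : R) :
  compact [set x : 'rV[R]_n | enorm (x - c) <= r].
Proof.
apply: bounded_closed_compact.
  exists (r + `|c|); split=> [|M rM x /= xr]; first exact: num_real.
  rewrite -[x](subrK c) (le_trans _ (ltW rM))// (le_trans (ler_normD _ _))//.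
  rewrite lerD2r.
  exact: le_trans (norm_le_enorm _ _ _) xr.
apply: (@preimage_closed _ _ (fun x : 'rV[R]_n => enorm (x - c))
  [set t | t <= r]) => [x _|]; first exact: enormB_continuous.
exact: closed_le.
Qed.

Lemma compact_enorm_sphere (R : realType) (n : nat) (c : 'rV[R]_n) (r : R) :
  compact [set x : 'rV[R]_n | enorm (x - c) = r].
Proof.
apply: subclosed_compact (@compact_enorm_ball R n c r) _; last first.
  by move=> x /= ->.
apply: (@preimage_closed _ _ (fun x : 'rV[R]_n => enorm (x - c))
  [set t | t = r]) => [x _|]; first exact: enormB_continuous.
exact: closed_eq.
Qed.

Lemma enorm_sphere_neq0 (R : realType) (n : nat) (c : 'rV[R]_n) (r : R) :
  (0 < n)%N -> 0 <= r -> [set x : 'rV[R]_n | enorm (x - c) = r] !=set0.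
Proof.
move=> n0 r0; exists (c + r *: delta_mx 0 (Ordinal n0)) => /=.
by rewrite addrC addKr enormZ enorm_delta mulr1 ger0_norm.
Qed.

Lemma near_enorm_ball (R : realType) (n : nat) (c : 'rV[R]_n)
    (P : set 'rV[R]_n) : nbhs c P ->
  \forall r \near 0^'+, forall x, enorm (x - c) <= r -> P x.
Proof.
move=> /nbhs_normP[e /= e0 eP]; near=> r => x xr; apply: eP => /=.
rewrite distrC (le_lt_trans (norm_le_enorm _ _ _))// (le_lt_trans xr)//.
Unshelve. all: by end_near. Qed.

(** * Attained maxima and minima over spheres *)

Section Extrema.
Context (R : realType) (n : nat) (h : 'rV[R]_n -> 'rV[R]_n).
Context (x0 : 'rV[R]_n) (t : R).
Hypotheses (n0 : (0 < n)%N) (t0 : 0 <= t).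
Hypothesis hc : forall x, enorm (x - x0) = t -> {for x, continuous h}.

Lemma dist_continuous x : {for x, continuous h} ->
  {for x, continuous (fun x => enorm (h x - h x0))}.
Proof.
move=> hx; apply: (@continuous_comp _ _ _ h (fun y => enorm (y - h x0))) => //.
exact: enormB_continuous.
Qed.

(** The sphere is compact, and nonempty because [0 < n], so the supremum is attained. Continuity is
    assumed only at points of the sphere. *)
Lemma omegaP : exists2 x, enorm (x - x0) = t &
  omega h x0 t = enorm (h x - h x0) /\
  forall y, enorm (y - x0) = t -> enorm (h y - h x0) <= omega h x0 t.
Proof.
have [|x /set_mem/= xt xmax] := @compact_EVT_max _ R
    (fun x => enorm (h x - h x0)) _
    (@enorm_sphere_neq0 R n x0 t n0 t0) (@compact_enorm_sphere R n x0 t).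
  apply: continuous_in_subspaceT => x /set_mem/= xt.
  exact/dist_continuous/hc.
have ub : ubound (sphere_dists h x0 t) (enorm (h x - h x0)).
  by move=> _ [y /= yt <-]; apply: xmax; rewrite inE.
have -> : omega h x0 t = enorm (h x - h x0).
  apply/le_anti/andP; split; first
    by apply: ge_sup => //; exists (enorm (h x - h x0)), x.
  by apply: ub_le_sup; [exists (enorm (h x - h x0))|exists x].
by exists x => //; split=> // y yt; apply: ub; exists y.
Qed.

Lemma min_stretchP : exists2 x, enorm (x - x0) = t &
  min_stretch h x0 t = enorm (h x - h x0) /\
  forall y, enorm (y - x0) = t -> min_stretch h x0 t <= enorm (h y - h x0).
Proof.
have [|x /set_mem/= xt xmin] := @compact_EVT_min _ R
    (fun x => enorm (h x - h x0)) _
    (@enorm_sphere_neq0 R n x0 t n0 t0) (@compact_enorm_sphere R n x0 t).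
  apply: continuous_in_subspaceT => x /set_mem/= xt.
  exact/dist_continuous/hc.
have lb : lbound (sphere_dists h x0 t) (enorm (h x - h x0)).
  by move=> _ [y /= yt <-]; apply: xmin; rewrite inE.
have -> : min_stretch h x0 t = enorm (h x - h x0).
  apply/le_anti/andP; split; last first.
    by apply: lb_le_inf => //; exists (enorm (h x - h x0)), x.
  by apply: ge_inf; [exists (enorm (h x - h x0))|exists x].
by exists x => //; split=> // y yt; apply: lb; exists y.
Qed.

End Extrema.

(** * Homeomorphisms between open sets *)

Lemma homeomorphism_continuous (R : realType) (n : nat)
    (X Y : set 'rV[R]_n) (h f : 'rV[R]_n -> 'rV[R]_n) :
  open X -> homeomorphism_with_inverse X Y h f ->
  forall x, X x -> {for x, continuous h}.
Proof.
move=> oX [_ _ + _] x Xx; rewrite continuous_open_subspace// => hc.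
by apply: hc; rewrite inE.
Qed.

(** Makes the setting symmetric, so that facts proved for [h] can be reused for [f]. *)
Lemma homeomorphism_inverse (R : realType) (n : nat)
    (X Y : set 'rV[R]_n) (h f : 'rV[R]_n -> 'rV[R]_n) :
  homeomorphism_with_inverse X Y h f -> homeomorphism_with_inverse Y X f h.
Proof.
move=> [[hXY hinj hsurj] fK hc fc].
have fX y : Y y -> X (f y) by move=> /hsurj[x Xx <-]; rewrite fK.
have hK y : Y y -> h (f y) = y by move=> /hsurj[x Xx <-]; rewrite fK.
split=> //; split.
- by move=> y; exact: fX.
- by move=> y z /set_mem Yy /set_mem Yz fyz; rewrite -[y]hK// fyz hK.
- by move=> x Xx; exists (h x); [exact: hXY|rewrite fK].
Qed.

(** * The minimal stretch of [h] and the modulus of [f] as mutually inverse functions *)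

Section Homeomorphism.
Context (R : realType) (n : nat) (X Y : set 'rV[R]_n).
Context (h f : 'rV[R]_n -> 'rV[R]_n) (x0 : 'rV[R]_n).
Hypotheses (n0 : (0 < n)%N) (oX : open X) (oY : open Y) (Xx0 : X x0).
Hypothesis hf : homeomorphism_with_inverse X Y h f.

Let hc x : X x -> {for x, continuous h}.
Proof. exact: (@homeomorphism_continuous R n X Y h f). Qed.

Let fc y : Y y -> {for y, continuous f}.
Proof.
exact: (homeomorphism_continuous _ _ _ _ _ _ oY
  (homeomorphism_inverse _ _ _ _ _ _ hf)).
Qed.

Let fK x : X x -> f (h x) = x. Proof. by case: hf => _ + _ _; apply. Qed.

Let hK y : Y y -> h (f y) = y.
Proof. by case: (homeomorphism_inverse _ _ _ _ _ _ hf) => _ + _ _; apply. Qed.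

Let hXY x : X x -> Y (h x). Proof. by case: hf => -[+ _ _ _ _ _]; apply. Qed.

Let fYX y : Y y -> X (f y).
Proof.
by case: (homeomorphism_inverse _ _ _ _ _ _ hf) => -[+ _ _ _ _ _]; apply.
Qed.

Lemma enorm_image_gt0 x : X x -> 0 < enorm (x - x0) -> 0 < enorm (h x - h x0).
Proof.
move=> Xx; rewrite !enormB_gt0; apply: contra_neq => hx.
by rewrite -(fK x Xx) hx fK.
Qed.

(** Push [x = f y] outward along the ray from [x0], to [x + a *: (x - x0)] with small [a > 0]. The
    distance to [x0] is multiplied by [1 + a], while continuity of [h] keeps the image in the open
    ball of radius [r]. The ray has a direction because [y] differs from [h x0]. *)
Lemma inverse_no_interior_max y r : Y y -> 0 < enorm (y - h x0) < r ->
  exists2 z, enorm (z - h x0) < r & Y z /\ enorm (f y - x0) < enorm (f z - x0).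
Proof.
move=> Yy /andP[y0 yr]; set x := f y.
have Xx : X x by exact: fYX.
pose p (a : R) := x + a *: (x - x0).
have pc : p a @[a --> (0 : R)] --> x.
  rewrite -[X in _ --> X]addr0 -(scale0r (x - x0)).
  by apply: cvgD; [exact: cvg_cst|apply: cvgZr_tmp; exact: cvg_id].
have near_p (P : set 'rV[R]_n) : nbhs x P -> \forall a \near 0^'+, P (p a).
  by move=> xP; apply: cvg_at_right_filter pc _ xP.
have Pz : nbhs x [set z | X z /\ enorm (h z - h x0) < r].
  apply: filterI; first exact: open_nbhs_nbhs.
  have hd : {for x, continuous (fun x => enorm (h x - h x0))}.
    exact/dist_continuous/hc.
  by apply: (cvgr_lt _ hd); rewrite /x hK.
have x_gt0 : 0 < enorm (x - x0).
  rewrite enormB_gt0; apply: contraTneq y0 => xx0.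
  by rewrite -xx0 /x hK// subrr enorm0 ltxx.
near (0 : R)^'+ => a.
have a0 : 0 < a by [].
have [Xp pr] : X (p a) /\ enorm (h (p a) - h x0) < r.
  by near: a; exact: near_p Pz.
exists (h (p a)) => //; split; first exact: hXY.
have pE : p a - x0 = (1 + a) *: (x - x0) by rewrite scalerDl scale1r /p addrAC.
by rewrite fK// pE enormZ gtr0_norm ?addr_gt0// ltr_pMl// ltrDl.
Unshelve. all: by end_near. Qed.

Lemma min_stretch_omega s : 0 < s ->
  (forall y, enorm (y - h x0) <= s -> Y y) ->
  (forall x, enorm (x - x0) <= omega f (h x0) s -> X x) ->
  min_stretch h x0 (omega f (h x0) s) = s.
Proof.
move=> s0 sY tX; set t := omega f (h x0) s.
have [|y ys []] := @omegaP R n f (h x0) s n0 (ltW s0).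
  by move=> y ys; apply/fc/sY; rewrite ys.
rewrite -/t fK// => ty ymax.
have Yy : Y y by apply: sY; rewrite ys.
have tX' x : enorm (x - x0) = t -> X x by move=> xt; apply: tX; rewrite xt.
have t0 : 0 <= t by rewrite ty enorm_ge0.
have [|x xt [-> xmin]] := @min_stretchP R n h x0 t n0 t0.
  by move=> x xt; exact/hc/tX'.
apply/le_anti/andP; split.
  (* The point [f y] lies on the sphere of radius [t], and [h] sends it to [y], at distance [s]. *)
  by rewrite -ys -[y in leRHS]hK//; exact: xmin.
rewrite leNgt; apply/negP => xs.
(* Suppose [h x] lies strictly inside the ball. Compare it with a maximiser [z] over the whole
   closed ball. *)
have [||z /set_mem/= zs zmax] := @compact_EVT_max _ R
    (fun z => enorm (f z - f (h x0))) _ _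
    (@compact_enorm_ball R n (h x0) s).
- by exists y; rewrite /= ys.
- apply: continuous_in_subspaceT => z /set_mem/= zs.
  exact/dist_continuous/fc/sY.
have fy_gt0 : 0 < enorm (f y - x0).
  rewrite enormB_gt0; apply: contraTneq s0 => fy0.
  by rewrite -ys -fy0 hK// subrr enorm0 ltxx.
(* An interior point doing at least as well as [z] is not the centre, since its value is at least
   that of [f y], which is positive. It can then be improved inside the ball, against the maximality
   of [z]. *)
have noint w : enorm (w - h x0) < s -> enorm (f z - x0) <= enorm (f w - x0) ->
    False.
  move=> ws zw; have Yw : Y w by exact/sY/ltW.
  have yz : enorm (f y - x0) <= enorm (f z - x0).
    by rewrite -{1}(fK x0 Xx0) -{2}(fK x0 Xx0); apply: zmax; rewrite inE/= ys.
  have w0 : 0 < enorm (w - h x0).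
    rewrite enormB_gt0.
    apply: contraTneq (lt_le_trans fy_gt0 (le_trans yz zw)) => ->.
    by rewrite fK// subrr enorm0 ltxx.
  have [|v vs [Yv]] := inverse_no_interior_max w s Yw; first by rewrite w0.
  apply/negP; rewrite -leNgt (le_trans _ zw)//.
  by rewrite -{1}(fK x0 Xx0) -{2}(fK x0 Xx0); apply: zmax; rewrite inE/= ltW.
(* An interior [z] contradicts [noint] itself. If [z] is on the sphere, its value is at most [t],
   which the interior point [h x] also reaches. *)
have [zs'|sz] := ltP (enorm (z - h x0)) s; first exact: (noint z).
apply: (noint (h x)) => //; rewrite fK ?xt; last exact: tX'.
by apply: ymax; apply/le_anti; rewrite zs.
Qed.

(** A minimiser [x] has [h x] on the sphere of radius [s] and [f (h x) = x], so the modulus is at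
    least [r]. If some [y] on that sphere had [f y] farther than [r], the segment from [h x0] to [y]
    would contain an earlier point whose image under [f] is at distance exactly [r]: a point of the
    [r]-sphere stretched by less than the minimum. *)
Lemma omega_min_stretch r : 0 < r ->
  (forall x, enorm (x - x0) <= r -> X x) ->
  (forall y, enorm (y - h x0) <= min_stretch h x0 r -> Y y) ->
  omega f (h x0) (min_stretch h x0 r) = r.
Proof.
move=> r0 rX sY; set s := min_stretch h x0 r.
have [|x xr []] := @min_stretchP R n h x0 r n0 (ltW r0).
  by move=> x xr; apply/hc/rX; rewrite xr.
rewrite -/s => sx xmin.
have Xx : X x by apply: rX; rewrite xr.
have s0 : 0 <= s by rewrite sx enorm_ge0.
have [|y ys []] := @omegaP R n f (h x0) s n0 s0.
  by move=> y ys; apply/fc/sY; rewrite ys.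
rewrite fK// => -> ymax.
apply/le_anti/andP; split; last first.
  by rewrite -[leLHS]xr -{1}(fK x Xx); exact: ymax.
rewrite leNgt; apply/negP => ry.
pose p (a : R) := h x0 + a *: (y - h x0).
have pE a : enorm (p a - h x0) = `|a| * s.
  by rewrite /p addrAC subrr add0r enormZ ys.
have pY a : a \in `[0, 1] -> Y (p a).
  rewrite in_itv/= => /andP[a0 a1]; apply: sY.
  by rewrite pE ger0_norm// ler_piMl.
have pc : continuous p.
  by move=> a; apply: cvgD; [exact: cvg_cst|apply: cvgZr_tmp; exact: cvg_id].
have [||a a01 ar] := @IVT R (fun a => enorm (f (p a) - x0)) 0 1 r ler01.
- apply: continuous_in_subspaceT => a /set_mem a01.
  apply: (@continuous_comp _ _ _ p (fun y => enorm (f y - x0))).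
    exact: pc.
  apply: (@continuous_comp _ _ _ f (fun x => enorm (x - x0))).
    exact/fc/pY.
  exact: enormB_continuous.
- rewrite /p scale0r addr0 scale1r subrKC fK// subrr enorm0.
  by rewrite ge_min (ltW r0) le_max (ltW ry) orbT.
(* At [a = 1] the distance is that of [f y], which exceeds [r]. Strictness here makes
   [a * s < s]. *)
have a1 : a < 1.
  rewrite lt_neqAle; move: (a01); rewrite in_itv/= => /andP[_ ->].
  rewrite andbT; apply/eqP => a1; move: ry.
  by rewrite -ar a1 /p scale1r subrKC ltxx.
have s_gt0 : 0 < s by rewrite sx enorm_image_gt0// xr.
have := xmin _ ar; rewrite hK; last exact: pY.
rewrite pE; move: a01; rewrite in_itv/= => /andP[a0 _].
by rewrite ger0_norm// leNgt gtr_pMl// a1.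
Qed.

(** Smallness comes from continuity at [x0], positivity from injectivity. With target [0^'+], any
    property of all small positive radii can be pulled back along the modulus. *)
Lemma omega_cvg0 : omega h x0 s @[s --> 0^'+] --> 0^'+.
Proof.
move=> P /nbhs_normP[e /= e0 eP].
have near_e : nbhs x0 [set x | X x /\ enorm (h x - h x0) < e].
  apply: filterI; first exact: open_nbhs_nbhs.
  have hd : {for x0, continuous (fun x => enorm (h x - h x0))}.
    exact/dist_continuous/hc.
  by apply: (cvgr_lt _ hd); rewrite subrr enorm0.
change (\forall s \near 0^'+, P (omega h x0 s)); near=> s.
have s0 : 0 < s by [].
have se : forall x, enorm (x - x0) <= s -> X x /\ enorm (h x - h x0) < e.
  by near: s; exact: near_enorm_ball.
have [|x xs [-> _]] := @omegaP R n h x0 s n0 (ltW s0).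
  by move=> x xs; apply/hc; have [|] := se x; rewrite ?xs.
have [|Xx xe] := se x; first by rewrite xs.
have hx0 : 0 < enorm (h x - h x0) by apply: enorm_image_gt0; rewrite ?xs.
by apply: eP => //=; rewrite sub0r normrN gtr0_norm.
Unshelve. all: by end_near. Qed.

(** Squeezed below the modulus, and positive because the minimum is attained. *)
Lemma min_stretch_cvg0 : min_stretch h x0 r @[r --> 0^'+] --> 0^'+.
Proof.
move=> P /nbhs_normP[e /= e0 eP].
change (\forall r \near 0^'+, P (min_stretch h x0 r)); near=> r.
have r0 : 0 < r by [].
have rX : forall x, enorm (x - x0) <= r -> X x.
  by near: r; apply: near_enorm_ball; exact: open_nbhs_nbhs.
have hr : forall x, enorm (x - x0) = r -> {for x, continuous h}.
  by move=> x xr; apply/hc/rX; rewrite xr.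
have re : omega h x0 r < e.
  by near: r; exact: omega_cvg0 (nbhs_right_lt e0).
have [x xr [-> _]] := @min_stretchP R n h x0 r n0 (ltW r0) hr.
have [_ _ [_ /(_ x xr) xo]] := @omegaP R n h x0 r n0 (ltW r0) hr.
have hx0 : 0 < enorm (h x - h x0).
  by apply: enorm_image_gt0; rewrite ?xr//; apply: rX; rewrite xr.
by apply: eP => //=; rewrite sub0r normrN gtr0_norm// (le_lt_trans xo).
Unshelve. all: by end_near. Qed.

End Homeomorphism.

(** * Changing variables between radii in the source and in the target *)

Section Moduli.
Context (R : realType) (n : nat) (X Y : set 'rV[R]_n).
Context (h f : 'rV[R]_n -> 'rV[R]_n) (x0 : 'rV[R]_n).
Hypotheses (n0 : (0 < n)%N) (oX : open X) (oY : open Y) (Xx0 : X x0).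
Hypothesis hf : homeomorphism_with_inverse X Y h f.

Let Yy0 : Y (h x0). Proof. by case: hf => -[+ _ _ _ _ _]; apply. Qed.

Let near_X : \forall r \near 0^'+, forall x, enorm (x - x0) <= r -> X x.
Proof. by apply: near_enorm_ball; exact: open_nbhs_nbhs. Qed.

Let near_Y : \forall s \near 0^'+, forall y, enorm (y - h x0) <= s -> Y y.
Proof. by apply: near_enorm_ball; exact: open_nbhs_nbhs. Qed.

Lemma omega_inverse_cvg0 : omega f (h x0) s @[s --> 0^'+] --> 0^'+.
Proof.
apply: (@omega_cvg0 R n Y X f h) => //; exact: homeomorphism_inverse.
Qed.

Lemma near_min_stretch_omega :
  \forall s \near 0^'+, min_stretch h x0 (omega f (h x0) s) = s.
Proof.
near=> s; apply: (@min_stretch_omega R n X Y) => //.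
- by near: s.
- by near: s; exact: omega_inverse_cvg0 near_X.
Unshelve. all: by end_near. Qed.

Lemma near_omega_min_stretch :
  \forall r \near 0^'+, omega f (h x0) (min_stretch h x0 r) = r.
Proof.
near=> r; apply: (@omega_min_stretch R n X Y) => //.
- by near: r.
- near: r.
  exact: (@min_stretch_cvg0 R n X Y h f x0 n0 oX Xx0 hf _ near_Y).
Unshelve. all: by end_near. Qed.

Lemma near_min_stretch_le_omega :
  \forall r \near 0^'+, min_stretch h x0 r <= omega h x0 r.
Proof.
near=> r.
have r0 : 0 < r by [].
have hr : forall x, enorm (x - x0) = r -> {for x, continuous h}.
  move=> x xr; apply: (@homeomorphism_continuous R n X Y h f) => //.
  suff rX : forall x, enorm (x - x0) <= r -> X x by apply: rX; rewrite xr.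
  by near: r.
have [x xr [-> _]] := @min_stretchP R n h x0 r n0 (ltW r0) hr.
by have [_ _ [_ /(_ x xr)]] := @omegaP R n h x0 r n0 (ltW r0) hr.
Unshelve. all: by end_near. Qed.

(** Substitute [r = omega f (h x0) s] in one direction and [s = min_stretch h x0 r] in the other.
    Both tend to [0^'+] and they invert each other near 0, so neither side misses small radii. *)
Lemma dilatation_at_le_nearP (K : R) :
  (\forall r \near 0^'+, dilatation_at h x0 r <= K) <->
  (\forall s \near 0^'+, omega h x0 (omega f (h x0) s) <= K * s).
Proof.
split=> HK.
  near=> s.
  have ms : min_stretch h x0 (omega f (h x0) s) = s.
    by near: s; exact: near_min_stretch_omega.
  have : dilatation_at h x0 (omega f (h x0) s) <= K.
    by near: s; exact: omega_inverse_cvg0 HK.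
  by rewrite /dilatation_at ms ler_pdivrMr.
have m0 := @min_stretch_cvg0 R n X Y h f x0 n0 oX Xx0 hf.
near=> r.
have om : omega f (h x0) (min_stretch h x0 r) = r.
  by near: r; exact: near_omega_min_stretch.
rewrite /dilatation_at ler_pdivrMr; last first.
  by near: r; exact: m0 (nbhs_right_gt 0).
(* Only the radius inside [omega h x0] is rewritten, which turns the goal into [HK] at
   [s = min_stretch h x0 r]. *)
rewrite -{1}om.
by near: r; exact: m0 HK.
Unshelve. all: by end_near. Qed.

(** On the sphere of radius [omega f (h x0) s] the maximum dominates the minimum, which is [s]. This
    gives the lower estimate with constant 1. *)
Lemma near_le_omega_omega :
  \forall s \near 0^'+, s <= omega h x0 (omega f (h x0) s).
Proof.
near=> s.
have {1}<- : min_stretch h x0 (omega f (h x0) s) = s.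
  by near: s; exact: near_min_stretch_omega.
by near: s; exact: omega_inverse_cvg0 near_min_stretch_le_omega.
Unshelve. all: by end_near. Qed.

End Moduli.

(** * Upper limits and eventual bounds *)

Lemma limf_esup_le (R : realType) (g : R -> R) (F : set_system R) (K : R) :
  (\forall r \near F, g r <= K) -> (limf_esup (EFin \o g) F <= K%:E)%E.
Proof.
move=> FK; apply: ge_ereal_inf.
exists (ereal_sup [set (g r)%:E | r in [set r | g r <= K]]).
  by exists [set r | g r <= K].
by apply: ge_ereal_sup => _ [r rK <-]; rewrite lee_fin.
Qed.

(** An infimum of suprema strictly below [K] yields one member of [F] with supremum below [K].
    Strictness matters: an upper limit equal to [K] may be approached from above. *)
Lemma near_le_of_limf_esup_lt (R : realType) (g : R -> R) (F : set_system R)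
    (K : R) :
  Filter F ->
  (limf_esup (EFin \o g) F < K%:E)%E -> \forall r \near F, g r <= K.
Proof.
move=> FF /ereal_inf_lt[_ [V FV <-] VK]; apply: filterS FV => r Vr.
rewrite -lee_fin (le_trans _ (ltW VK))//.
by apply: ereal_sup_ubound; exists r.
Qed.

Theorem theorem1p1 (R : realType) (n : nat) (hn : (2 <= n)%N)
    (X Y : set 'rV[R]_n) (domX : domain X) (domY : domain Y)
    (h f : 'rV[R]_n -> 'rV[R]_n)
    (hf : homeomorphism_with_inverse X Y h f) :
  quasiconformal X h <->
  exists2 K : R, 1 <= K &
    forall x0 y0 : 'rV[R]_n, X x0 -> Y y0 -> y0 = h x0 ->
      \forall s \near 0^'+,
        K^-1 * s <= omega h x0 (omega f y0 s) /\
        omega h x0 (omega f y0 s) <= K * s.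
Proof.
have n0 : (0 < n)%N by exact: ltnW.
have [[_ oX _] [_ oY _]] := (domX, domY).
split=> [qc|[K K1 hK]].
  (* A real bound strictly above the supremum is needed to turn upper limits into eventual bounds.
     The formal value [-oo] is covered by [L = 0]. *)
  have [L hL] : exists L : R,
      (ereal_sup [set dilatation h x0 | x0 in X] < L%:E)%E.
    move: qc; rewrite /quasiconformal; case: ereal_sup => [r _| //|_].
      by exists (r + 1); rewrite lte_fin ltrDl.
    by exists 0; rewrite ltNyr.
  (* The maximum with 1 ensures [1 <= K], hence [K^-1 * s <= s] for the lower estimate. *)
  exists (Num.max 1 L) => [|x0 _ Xx0 _ ->]; first by rewrite le_max lexx.
  have near_L : \forall r \near 0^'+, dilatation_at h x0 r <= Num.max 1 L.
    apply: near_le_of_limf_esup_lt; apply: lt_le_trans (_ : L%:E <= _)%E.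
      by apply: le_lt_trans hL; apply: ereal_sup_ubound; exists x0.
    by rewrite lee_fin le_max lexx orbT.
  near=> s; split.
    apply: (@le_trans _ _ s).
      by rewrite ler_piMl// invf_le1 ?le_max ?lexx// lt_max ltr01.
    by near: s; exact: (@near_le_omega_omega R n X Y).
  by near: s; apply/(@dilatation_at_le_nearP R n X Y h f).
(* As [K] does not depend on the point, it bounds the supremum of all the dilatations. *)
apply: (@le_lt_trans _ _ K%:E); last exact: ltry.
apply: ge_ereal_sup => _ [x0 Xx0 <-]; apply: limf_esup_le.
apply/(@dilatation_at_le_nearP R n X Y h f) => //.
have Yy0 : Y (h x0) by case: hf => -[+ _ _ _ _ _]; apply.
by apply: filterS (hK x0 (h x0) Xx0 Yy0 erefl) => s [].
Unshelve. all: by end_near. Qed.
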